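(* Consider a tensor network with $n \ge 2$ leaves, of which $n_c \ge 1$ are green. For a binary contraction tree $T$ let $V(T)$ be its real-skeleton volume, $m(T)$ and $r(T)$ its merge and ride volume fractions, and $C(T) = \bigl(1 + 2m(T) + r(T)\bigr)V(T)$ its realified cost; let $V^* = \min_T V(T)$ and $C^* = \min_T C(T)$, the minima being over all binary contraction trees of the network. Let $0 \le \epsilon \le 1/2$ and suppose that $$m(T) \ge 1 - \epsilon \qquad \text{for every tree } T \text{ with } V(T) \le 3V^*.$$ Then every skeleton-optimal tree $T_0$ (that is, every tree with $V(T_0) = V^*$) satisfies $$\frac{C(T_0)}{C^*} \le \frac{3}{3 - 2\epsilon} \le 1 + \epsilon.$$
   Context: A tensor network is a finite collection of tensors (leaves) whose axes are labelled by indices; each index has a dimension $\ge 1$, some indices are designated open, and every non-open index appears on at least two tensors. Each leaf is either green (complex) or real. A binary contraction tree is a full binary tree whose leaves are the tensors of the network; each internal node is a pairwise contraction step whose operands are the tensors at its two children. The tensor at a node whose subtree contains the leaf set $S$ carries exactly those indices that appear on some leaf in $S$ and are either open or also appear on a leaf outside $S$. The volume of a step is the product of the dimensions of all indices occurring on at least one of its two operands (contractions of operands sharing no index are allowed). The real-skeleton volume $V(T)$ is the sum of the volumes of all steps of $T$. An operand is green if and only if its subtree contains at least one green leaf; a step is a merge if both operands are green, a ride if exactly one is, and a pass if neither is. The fractions $m(T)$ and $r(T)$ are the shares of $V(T)$ carried by merge steps and by ride steps. *)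

(* Defs.v *)
From HB Require Import structures.
From mathcomp Require Import all_boot all_order all_algebra.

Set Implicit Arguments.
Unset Strict Implicit.
Unset Printing Implicit Defensive.

Import Order.TTheory GRing.Theory Num.Theory.
Local Open Scope ring_scope.

(* Only the set of indices on a tensor matters for volumes, so the axes of a
   leaf are recorded as a set of indices; the entries of the tensors play no
   role. *)
Record tensor_network (n : nat) := TensorNetwork {
  index : finType;
  dim : index -> nat;
  open_indices : {set index};
  axes : 'I_n -> {set index};
  green : {set 'I_n};
  dim_ge1 : forall i, (1 <= dim i)%N;
  closed_index_ge2 : forall i, i \notin open_indices ->
    (2 <= #|[set l | i \in axes l]|)%N
}.

Inductive btree (L : Type) := Leaf of L | Node of btree L & btree L.

Section BinaryTree.
Variable L : Type.
Implicit Types t : btree L.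

Fixpoint leaves t : seq L :=
  match t with
  | Leaf l => [:: l]
  | Node a b => leaves a ++ leaves b
  end.

(* One pair of operand subtrees per internal node. *)
Fixpoint steps t : seq (btree L * btree L) :=
  match t with
  | Leaf _ => [::]
  | Node a b => (a, b) :: steps a ++ steps b
  end.

Fixpoint encode t : GenTree.tree L :=
  match t with
  | Leaf l => GenTree.Leaf l
  | Node a b => GenTree.Node 0 [:: encode a; encode b]
  end.

Fixpoint decode (g : GenTree.tree L) : option (btree L) :=
  match g with
  | GenTree.Leaf l => Some (Leaf l)
  | GenTree.Node _ [:: a; b] =>
      if decode a is Some a' then
        if decode b is Some b' then Some (Node a' b') else None
      else None
  | _ => None
  end.

Lemma encodeK : pcancel encode decode.
Proof. by elim=> //= a -> b ->. Qed.

End BinaryTree.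

HB.instance Definition _ (L : eqType) :=
  Equality.copy (btree L) (pcan_type (@encodeK L)).
HB.instance Definition _ (L : choiceType) :=
  Choice.copy (btree L) (pcan_type (@encodeK L)).
HB.instance Definition _ (L : countType) :=
  Countable.copy (btree L) (pcan_type (@encodeK L)).

(* The two children of a node are ordered here; none of the quantities below
   depends on that order. *)
Record contraction_tree (n : nat) := ContractionTree {
  ctree_val :> btree 'I_n;
  ctree_leavesP : perm_eq (leaves ctree_val) (enum 'I_n)
}.

HB.instance Definition _ n := [isSub for @ctree_val n].
HB.instance Definition _ n := [Countable of contraction_tree n by <:].

Section Finiteness.
Variable n : nat.

Fixpoint trees_upto (d : nat) : seq (btree 'I_n) :=
  [seq Leaf l | l <- enum 'I_n] ++
  (if d is d'.+1 then
     [seq Node a b | a <- trees_upto d', b <- trees_upto d'] else [::]).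

Lemma size_leaves_gt0 (t : btree 'I_n) : (0 < size (leaves t))%N.
Proof. by elim: t => //= a ha b hb; rewrite size_cat addn_gt0 ha. Qed.

Lemma mem_trees_upto d t : (size (leaves t) <= d)%N -> t \in trees_upto d.
Proof.
elim: d t => [|d IHd] [l|a b] /=; rewrite ?mem_cat.
- by [].
- by rewrite leqNgt size_cat addn_gt0 size_leaves_gt0.
- by move=> _; rewrite map_f ?mem_enum.
- move=> h; apply/orP; right; apply: allpairs_f; apply: IHd;
    rewrite -ltnS; apply: leq_trans h; rewrite size_cat.
  + by rewrite -addn1 leq_add2l size_leaves_gt0.
  + by rewrite -add1n leq_add2r size_leaves_gt0.
Qed.

Definition ctree_enum : seq (contraction_tree n) :=
  undup (pmap insub (trees_upto n)).

Lemma ctree_enumP : Finite.axiom ctree_enum.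
Proof.
apply: Finite.uniq_enumP; first exact: undup_uniq.
move=> T; rewrite mem_undup mem_pmap_sub inE /=; apply: mem_trees_upto.
by rewrite (perm_size (ctree_leavesP T)) size_enum_ord.
Qed.

HB.instance Definition _ := isFinite.Build (contraction_tree n) ctree_enumP.

Lemma contraction_tree_exists : (0 < n)%N -> inhabited (contraction_tree n).
Proof.
move=> n_gt0.
have H (s : seq 'I_n) : s != [::] -> exists t, leaves t = s.
  elim: s => // x [|y s] IHs _; first by exists (Leaf x).
  by have [//|t ts] := IHs; exists (Node (Leaf x) t); rewrite /= ts.
have [|t ht] := H (enum 'I_n); first by rewrite -size_eq0 size_enum_ord -lt0n.
have e : perm_eq (leaves t) (enum 'I_n) by rewrite ht.
exact: (inhabits (ContractionTree e)).
Qed.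

End Finiteness.

Section Volumes.
Variables (n : nat) (N : tensor_network n).
Implicit Types (t a b : btree 'I_n) (s : btree 'I_n * btree 'I_n).

Definition leaf_set t : {set 'I_n} := [set l in leaves t].

Definition node_indices t : {set index N} :=
  [set i | [exists l in leaf_set t, i \in axes N l] &&
     ((i \in open_indices N) || [exists l in ~: leaf_set t, i \in axes N l])].

Definition step_volume s : nat :=
  (\prod_(i in node_indices s.1 :|: node_indices s.2) dim i)%N.

Definition is_green t : bool := [exists l in leaf_set t, l \in green N].

Definition is_merge s : bool := is_green s.1 && is_green s.2.
Definition is_ride s : bool := is_green s.1 (+) is_green s.2.

End Volumes.

Section Costs.
Variables (R : realFieldType) (n : nat) (N : tensor_network n).
Implicit Types T : contraction_tree n.

Definition skeleton_volume T : R :=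
  \sum_(s <- steps T) (step_volume N s)%:R.

Definition merge_fraction T : R :=
  (\sum_(s <- steps T | is_merge N s) (step_volume N s)%:R) / skeleton_volume T.

Definition ride_fraction T : R :=
  (\sum_(s <- steps T | is_ride N s) (step_volume N s)%:R) / skeleton_volume T.

Definition realified_cost T : R :=
  (1 + 2 * merge_fraction T + ride_fraction T) * skeleton_volume T.

End Costs.

(* Total: the value on an empty domain is the junk value 0. *)
Definition min_value (R : realFieldType) (D : finType) (f : D -> R) : R :=
  if [pick x : D] is Some x0 then f [arg min_(x < x0) f x]%O else 0.

Lemma min_valueP (R : realFieldType) (D : finType) (f : D -> R) :
  inhabited D ->
  (exists x, f x = min_value f) /\ (forall x, min_value f <= f x).
Proof.
case=> y; rewrite /min_value; case: pickP => [x0 _|/(_ y)//].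
by case: arg_minP => // x _ hx; split=> [|z]; [exists x | exact: hx].
Qed.

Definition min_volume (R : realFieldType) n (N : tensor_network n) : R :=
  min_value (skeleton_volume R N).

Definition min_cost (R : realFieldType) n (N : tensor_network n) : R :=
  min_value (realified_cost R N).

(* Main.v *)
Require Import Defs.
From mathcomp Require Import all_boot all_order all_algebra.
From mathcomp Require Import lra.

Import Order.TTheory GRing.Theory Num.Theory.
Local Open Scope ring_scope.

(** Since [m + r <= 1], every cost satisfies [C <= 3 V]; in particular
    [C(T0) <= 3 V*]. A cost-optimal tree [T1] either has [V(T1) <= 3 V*], and
    then [C(T1) >= (1 + 2 (1 - eps)) V(T1) >= (3 - 2 eps) V*], or it has
    [C(T1) >= V(T1) > 3 V*]. *)

Section Costs.
Variables (R : realFieldType) (n : nat) (N : tensor_network n).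
Implicit Types T : contraction_tree n.

Lemma skeleton_volume_ge0 T : 0 <= skeleton_volume R N T.
Proof. by apply: sumr_ge0 => s _; apply: ler0n. Qed.

Lemma merge_fraction_ge0 T : 0 <= merge_fraction R N T.
Proof.
by apply: divr_ge0; [apply: sumr_ge0 => s _; apply: ler0n
                    | apply: skeleton_volume_ge0].
Qed.

Lemma ride_fraction_ge0 T : 0 <= ride_fraction R N T.
Proof.
by apply: divr_ge0; [apply: sumr_ge0 => s _; apply: ler0n
                    | apply: skeleton_volume_ge0].
Qed.

(** No step is both a merge and a ride, so the two sums together count each step volume at most
    once. *)
Lemma merge_ride_fraction_le1 T :
  merge_fraction R N T + ride_fraction R N T <= 1.
Proof.
rewrite /merge_fraction /ride_fraction -mulrDl.
(* A one-leaf tree has no steps and volume 0; division by 0 yields 0, so both fractions vanish. *)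
have [V0|V0] := eqVneq (skeleton_volume R N T) 0.
  by rewrite V0 invr0 mulr0 ler01.
have Vgt0 : 0 < skeleton_volume R N T by rewrite lt_def V0 skeleton_volume_ge0.
rewrite ler_pdivrMr // mul1r /skeleton_volume [X in X + _]big_mkcond.
rewrite [X in _ + X]big_mkcond -big_split /=; apply: ler_sum => s _.
rewrite /is_merge /is_ride.
by case: (is_green N s.1); case: (is_green N s.2);
  rewrite /= ?addr0 ?add0r ?ler0n.
Qed.

Lemma realified_cost_le T : realified_cost R N T <= 3 * skeleton_volume R N T.
Proof.
apply: ler_wpM2r; first exact: skeleton_volume_ge0.
have := merge_ride_fraction_le1 T; have := ride_fraction_ge0 T; lra.
Qed.

Lemma realified_cost_ge T :
  (1 + 2 * merge_fraction R N T) * skeleton_volume R N T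
    <= realified_cost R N T.
Proof.
apply: ler_wpM2r; first exact: skeleton_volume_ge0.
by rewrite lerDl ride_fraction_ge0.
Qed.

Lemma skeleton_volume_le_cost T : skeleton_volume R N T <= realified_cost R N T.
Proof.
apply: le_trans (realified_cost_ge T).
by rewrite ler_peMl ?skeleton_volume_ge0 // lerDl mulr_ge0 ?merge_fraction_ge0.
Qed.

End Costs.

Theorem theorem6 (R : realFieldType) (n : nat) (hn : (2 <= n)%N)
    (N : tensor_network n) (hgreen : (1 <= #|green N|)%N)
    (eps : R) (heps0 : 0 <= eps) (heps : eps <= 1 / 2)
    (hmerge : forall T : contraction_tree n,
       skeleton_volume R N T <= 3 * min_volume R N ->
       1 - eps <= merge_fraction R N T) :
  forall T0 : contraction_tree n,
    skeleton_volume R N T0 = min_volume R N ->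
    realified_cost R N T0 / min_cost R N <= 3 / (3 - 2 * eps) /\
    3 / (3 - 2 * eps) <= 1 + eps.
Proof.
move=> T0 VT0; have d_gt0 : 0 < 3 - 2 * eps by lra.
(* [(1 + eps) * (3 - 2 * eps) - 3 = eps * (1 - 2 * eps)], nonnegative since [0 <= eps <= 1 / 2]. *)
split; last by rewrite ler_pdivrMr //; nra.
rewrite /min_cost.
have [[T1 <-] _] := @min_valueP R _ (realified_cost R N) (inhabits T0).
have [_ /(_ T1) minV] := @min_valueP R _ (skeleton_volume R N) (inhabits T0).
rewrite -/(min_volume R N) -VT0 in minV.
have C0le := @realified_cost_le R n N T0.
have V0ge0 := @skeleton_volume_ge0 R n N T0.
have V1le := @skeleton_volume_le_cost R n N T1.
(* The bound in cross-multiplied form, which makes sense before the minimal cost is known to be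
   nonzero. *)
have key : realified_cost R N T0 * (3 - 2 * eps) <= 3 * realified_cost R N T1.
  have [V1small|V1large] :=
    lerP (skeleton_volume R N T1) (3 * min_volume R N).
    have C1ge := @realified_cost_ge R n N T1.
    have := hmerge T1 V1small; nra.
  (* Writing [Vi], [Ci] for the volume and cost of [Ti]: [C0 * (3 - 2 * eps) <= 9 * V0 <= 3 * V1 <=
     3 * C1]. *)
  rewrite -VT0 in V1large; nra.
(* A zero minimal cost makes the quotient 0, by the convention for the inverse of 0. *)
have [C10|C1n0] := eqVneq (realified_cost R N T1) 0.
  by rewrite C10 invr0 mulr0 divr_ge0 // ltW.
have C1gt0 : 0 < realified_cost R N T1 by rewrite lt_def C1n0; lra.
by rewrite ler_pdivrMr // mulrAC ler_pdivlMr.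
Qed.
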